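(* Let $\pi$ be a representation of a normed $*$-algebra $A$ in a pre-Hilbert space $H$. Assume that $\pi$ is weakly continuous on $A_{sa}$. Then the operators $\pi(a)$ $(a\in A)$ are all bounded, with $$\|\pi(a)\|\leq \mathrm{r}_\sigma(a)\quad\text{for all } a\in A.$$
   Context: All algebras and pre-Hilbert spaces are complex. A normed $*$-algebra is a $*$-algebra (algebra with conjugate-linear, anti-multiplicative involution $a\mapsto a^*$) equipped with a submultiplicative norm $|\cdot|$; no completeness, unit, or continuity of the involution is assumed. $A_{sa}=\{a\in A: a=a^*\}$. A representation of a $*$-algebra $A$ in a pre-Hilbert space $(H,\langle\cdot,\cdot\rangle)$ is an algebra homomorphism $\pi$ from $A$ to the algebra of all linear operators $H\to H$ such that $\langle\pi(a)x,y\rangle=\langle x,\pi(a^* )y\rangle$ for all $x,y\in H$, $a\in A$. It is weakly continuous on $A_{sa}$ if for every $x\in H$ the functional $a\mapsto\langle\pi(a)x,x\rangle$ is continuous on $A_{sa}$. For $a\in A$: $\mathrm{r}_\lambda(a)=\inf_{n\geq1}|a^n|^{1/n}$ and $\mathrm{r}_\sigma(a)=\mathrm{r}_\lambda(a^*a)^{1/2}$. *)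

(* Defs.v *)
From HB Require Import structures.
From mathcomp Require Import all_boot all_order all_algebra.
From mathcomp Require Import all_classical all_reals all_analysis.
From mathcomp Require Import sesquilinear complex.

Set Implicit Arguments.
Unset Strict Implicit.
Unset Printing Implicit Defensive.

Import Order.TTheory GRing.Theory Num.Theory.
Import numFieldNormedType.Exports.

Local Open Scope classical_set_scope.
Local Open Scope complex_scope.
Local Open Scope ring_scope.

(* Rings in MathComp have a unit, hence the separate hierarchy below for
   algebras that are not assumed to be unital. *)
HB.mixin Record Lmodule_isStarAlgebra (K : numClosedFieldType) A
    of GRing.Lmodule K A := {
  amul : A -> A -> A ;
  star : A -> A ;
  amulA : associative amul ;
  amulDl : left_distributive amul +%R ;
  amulDr : right_distributive amul +%R ;
  amulZl : forall (k : K) (a b : A), amul (k *: a) b = k *: amul a b ;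
  amulZr : forall (k : K) (a b : A), amul a (k *: b) = k *: amul a b ;
  starK : involutive star ;
  starD : {morph star : a b / a + b} ;
  starZ : forall (k : K) (a : A), star (k *: a) = (Num.conj k) *: star a ;
  starM : forall a b : A, star (amul a b) = amul (star b) (star a)
}.

#[short(type="starAlgType")]
HB.structure Definition StarAlgebra (K : numClosedFieldType) :=
  {A of GRing.Lmodule K A & Lmodule_isStarAlgebra K A}.

HB.mixin Record StarAlgebra_isNormed (K : numClosedFieldType) A
    of StarAlgebra K A & NormedModule K A := {
  norm_amul_le : forall a b : A, `|amul a b| <= `|a| * `|b|
}.

#[short(type="normedStarAlgType")]
HB.structure Definition NormedStarAlgebra (K : numClosedFieldType) :=
  {A of StarAlgebra K A & NormedModule K A & StarAlgebra_isNormed K A}.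

Definition selfadjoint (K : numClosedFieldType) (A : starAlgType K) : set A :=
  [set a | star a = a].
Arguments selfadjoint {K} A _.

(* There is no unit, so powers are indexed from one: apowS a n is the
   (n+1)-st power of a. *)
Fixpoint apowS (K : numClosedFieldType) (A : starAlgType K) (a : A) (n : nat) :
  A := if n is m.+1 then amul a (apowS a m) else a.

Section SpectralRadii.
Context {R : realType} {A : normedStarAlgType R[i]}.

(* The library norm of a module over R[i] takes its values in R[i]. *)
Definition rnorm (a : A) : R := complex.Re `|a|.

Definition r_lambda (a : A) : R :=
  inf [set rnorm (apowS a n) `^ (n.+1%:R)^-1 | n in [set: nat]].

Definition r_sigma (a : A) : R := Num.sqrt (r_lambda (amul (star a) a)).

End SpectralRadii.

Section PreHilbert.
Context {R : realType} {H : lmodType R[i]}.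
Variable dot : {dot H for @Num.conj R[i]}.

Definition hnorm (x : H) : R := Num.sqrt (complex.Re (dot x x)).

Definition bounded_op (T : {linear H -> H}) : Prop :=
  exists M : R, forall x : H, hnorm (T x) <= M * hnorm x.

(* Meaningful when bounded_op T holds: sup returns 0 on unbounded sets. *)
Definition opnorm (T : {linear H -> H}) : R :=
  sup [set hnorm (T x) | x in [set x : H | hnorm x <= 1]].

Record representation (A : starAlgType R[i]) (pi : A -> {linear H -> H}) :
    Prop := Representation {
  repD : forall (a b : A) (x : H), pi (a + b) x = pi a x + pi b x ;
  repZ : forall (k : R[i]) (a : A) (x : H), pi (k *: a) x = k *: pi a x ;
  repM : forall (a b : A) (x : H), pi (amul a b) x = pi a (pi b x) ;
  rep_star : forall (a : A) (x y : H), dot (pi a x) y = dot x (pi (star a) y)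
}.

Definition weakly_continuous_on_sa (A : normedStarAlgType R[i])
    (pi : A -> {linear H -> H}) : Prop :=
  forall x : H,
    {within selfadjoint A, continuous (fun a : A => dot (pi a x) x : R[i]^o)}.

End PreHilbert.

(* Main.v *)
Require Import Defs.
From mathcomp Require Import all_boot all_order all_algebra.
From mathcomp Require Import all_classical all_reals all_analysis.
From mathcomp Require Import sesquilinear complex.
From mathcomp Require Import ring lra.

Import Order.TTheory GRing.Theory Num.Theory.
Import numFieldNormedType.Exports.

Local Open Scope complex_scope.
Local Open Scope ring_scope.

(** Fix a vector x and put b = (star a) a and s_k = <pi(b)^k x, x>, so that
    s_0 = |x|^2 and s_1 = |pi(a) x|^2. It suffices to show, for every m >= 1,
    that s_1^m <= s_0^m |b^m|: an m-th root and the infimum over m then give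
    s_1 <= r_lambda(b) s_0, that is |pi(a) x| <= r_sigma(a) |x|.

    The s_k behave like the moments of a positive measure. Applying pi(a) and
    pi(star a) alternately to x produces vectors v_k with |v_k|^2 = s_k and
    <v_(k+2), v_k> = s_(k+1), so the Cauchy-Schwarz inequality makes the
    sequence s log-convex ([moment_log_convex]), whence s_1^K s_0 <= s_0^K s_K
    for every K ([log_convex_pow]).

    Weak continuity at the origin provides a constant C, which depends on x,
    such that <pi(c) x, x> <= C |c| for all self-adjoint c
    ([weakly_continuous_bound]). With c = (b^m)^k this bounds s_(mk) by
    C |b^m|^k, and therefore (s_1^m)^k s_0 <= C (s_0^m |b^m|)^k for all k >= 1.
    If s_0 = 0 then s_1 = 0 by Cauchy-Schwarz; otherwise, as k grows, the
    constant C becomes irrelevant ([le_of_geometric_bound]), and the claim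
    follows ([moment1_le]). Working with the powers of b^m for a fixed
    m reaches the infimum that defines r_lambda directly, without the limit
    formula for the spectral radius. *)

(** * Real sequences *)

(** The ratios s_(k+1) / s_k of a log-convex sequence increase, so each of them
    is at least s_1 / s_0; the product of the first k ratios is s_k / s_0. *)
Lemma log_convex_pow (R : realFieldType) (s : nat -> R) :
  (forall k, 0 <= s k) -> (forall k, s k.+1 ^+ 2 <= s k * s k.+2) ->
  forall k, s 1%N ^+ k * s 0%N <= s 0%N ^+ k * s k.
Proof.
move=> s_ge0 s_cvx.
have ratio k : s 1%N * s k <= s 0%N * s k.+1.
  elim: k => [|k IH]; first by rewrite mulrC.
  (* A zero term propagates to the right, which settles the degenerate case. *)
  have [sk0|skn0] := eqVneq (s k) 0.
    have := s_cvx k; rewrite sk0 mul0r => sq_le0.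
    have /eqP : s k.+1 ^+ 2 == 0 by rewrite eq_le sq_le0 sqr_ge0.
    move/eqP; rewrite sqrf_eq0 => /eqP ->.
    by rewrite mulr0 mulr_ge0.
  have sk_gt0 : 0 < s k by rewrite lt_def skn0 s_ge0.
  rewrite -(ler_pM2r sk_gt0).
  apply: (le_trans (y := s 0%N * s k.+1 ^+ 2)).
    rewrite expr2 mulrA mulrAC; exact: ler_wpM2r.
  by rewrite -mulrA [_ * s k]mulrC; exact: ler_wpM2l.
elim=> [|k IH]; first by rewrite !expr0.
rewrite !exprS -!mulrA; apply: (le_trans (ler_wpM2l (s_ge0 _) IH)).
rewrite mulrCA [leRHS]mulrCA; apply: ler_wpM2l; first exact: exprn_ge0.
exact: ratio.
Qed.

(** If z < y, then 1 <= D (z / y)^k for arbitrarily large k, although the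
    right-hand side tends to 0. *)
Lemma le_of_geometric_bound (R : realType) (D y z : R) :
  0 <= y -> 0 <= z -> (forall k, y ^+ k.+1 <= D * z ^+ k.+1) -> y <= z.
Proof.
move=> y_ge0 z_ge0 bnd; rewrite leNgt; apply/negP => z_lt_y.
have y_gt0 : 0 < y := le_lt_trans z_ge0 z_lt_y.
set q := z / y.
have q_lt1 : `|q| < 1.
  by rewrite ger0_norm ?divr_ge0// ltr_pdivrMr// mul1r.
have ge1 n : 1 <= (D * q) * q ^+ n.
  rewrite -mulrA -exprS expr_div_n mulrA ler_pdivlMr ?exprn_gt0// mul1r.
  exact: bnd.
have := cvg_geometric (D * q) q_lt1.
move=> cv.
suff: 1 <= lim (geometric (D * q) q @ \oo)%classic.
  by rewrite (cvg_lim _ cv)// ler10.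
apply: limr_ge; first exact: cvgP cv.
by near=> n; exact: ge1.
Unshelve. all: by end_near. Qed.

(** * Real parts and the Cauchy-Schwarz inequality *)

Lemma ReN (R : rcfType) (z : R[i]) : complex.Re (- z) = - complex.Re z.
Proof. by case: z. Qed.

Lemma Re_addJ (R : rcfType) (z : R[i]) :
  complex.Re (z + Num.conj z) = 2 * complex.Re z.
Proof. by case: z => a b; rewrite mulr_natl mulr2n. Qed.

Lemma conj_realC (R : rcfType) (t : R) : Num.conj (t%:C) = t%:C.
Proof. exact: conjc_real. Qed.

Lemma ReD (R : rcfType) (z w : R[i]) :
  complex.Re (z + w) = complex.Re z + complex.Re w.
Proof. by case: z w => [a b] [c d]. Qed.

Lemma Re_realM (R : rcfType) (t : R) (z : R[i]) :
  complex.Re (t%:C * z) = t * complex.Re z.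
Proof. by case: z => a b /=; rewrite mul0r subr0. Qed.

Lemma le_Re (R : rcfType) (z w : R[i]) : z <= w -> complex.Re z <= complex.Re w.
Proof. by rewrite lecE => /andP[]. Qed.

Lemma dot_Re_ge0 (R : realType) (H : lmodType R[i])
    (dot : {dot H for @Num.conj R[i]}) (u : H) : 0 <= complex.Re (dot u u).
Proof. exact: (le_Re _ _ _ (dnorm_ge0 dot u)). Qed.

(** The squared norm of u - t v is nonnegative, in particular at the real t that
    minimizes it. *)
Lemma dot_Re_CauchySchwarz (R : realType) (H : lmodType R[i])
    (dot : {dot H for @Num.conj R[i]}) (u v : H) :
  complex.Re (dot u v) ^+ 2 <= complex.Re (dot u u) * complex.Re (dot v v).
Proof.
have [->|v_neq0] := eqVneq v 0.
  by rewrite !linear0r expr0n.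
have vv_gt0 : 0 < complex.Re (dot v v).
  rewrite lt_def dot_Re_ge0 andbT; apply: contra v_neq0 => /eqP vv0.
  rewrite -(dnorm_eq0 dot) -[dot v v]RRe_real ?vv0//.
  by rewrite ger0_real// dnorm_ge0.
set t := complex.Re (dot u v) / complex.Re (dot v v).
have := dot_Re_ge0 _ _ dot (u - t%:C *: v).
rewrite dnormB dnormZ linearZr_LR /= conj_realC.
rewrite ReD ReN Re_addJ ReD Re_realM.
have -> : `|t%:C| ^+ 2 = (t ^+ 2)%:C.
  by rewrite real_normK ?rmorphXn// complex_real.
rewrite Re_realM.
have -> : complex.Re (dot u v) = t * complex.Re (dot v v).
  by rewrite divfK// gt_eqF.
nra.
Qed.

(** * The norm and the powers of a normed star-algebra *)

Lemma complex_normE (R : realType) (V : normedModType R[i]) (x : V) :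
  `|x| = (complex.Re `|x|)%:C.
Proof. by rewrite RRe_real ?ger0_real. Qed.

Lemma rnorm_ge0 (R : realType) (A : normedStarAlgType R[i]) (a : A) :
  0 <= rnorm a.
Proof. exact: (le_Re _ _ _ (normr_ge0 a)). Qed.

Lemma rnorm_gt0 (R : realType) (A : normedStarAlgType R[i]) (a : A) :
  a != 0 -> 0 < rnorm a.
Proof. by rewrite -normr_gt0 ltcE => /andP[]. Qed.

Lemma rnormZ_real (R : realType) (A : normedStarAlgType R[i]) (t : R) (a : A) :
  rnorm (t%:C *: a) = `|t| * rnorm a.
Proof.
by rewrite /rnorm normrZ normc_def /= expr0n addr0 sqrtr_sqr Re_realM.
Qed.

Lemma rnorm_amul_le (R : realType) (A : normedStarAlgType R[i]) (a b : A) :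
  rnorm (amul a b) <= rnorm a * rnorm b.
Proof.
apply: le_trans (le_Re _ _ _ (norm_amul_le a b)) _.
by rewrite (complex_normE _ _ a) Re_realM.
Qed.

Lemma rnorm_apowS_le (R : realType) (A : normedStarAlgType R[i]) (a : A) k :
  rnorm (apowS a k) <= rnorm a ^+ k.+1.
Proof.
elim: k => [|k IH] //=; apply: (le_trans (rnorm_amul_le _ _ _ _)).
by rewrite exprS ler_wpM2l// rnorm_ge0.
Qed.

Lemma amul_apowSC (K : numClosedFieldType) (A : starAlgType K) (a : A) k :
  amul (apowS a k) a = amul a (apowS a k).
Proof. by elim: k => [|k IH] //=; rewrite -amulA IH. Qed.

Lemma selfadjoint_apowS (K : numClosedFieldType) (A : starAlgType K) (a : A) k :
  selfadjoint A a -> selfadjoint A (apowS a k).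
Proof.
rewrite /selfadjoint /= => sa_a; elim: k => [|k IH] //=.
by rewrite starM IH sa_a amul_apowSC.
Qed.

(** * Weak continuity at the origin *)

(** Self-adjoint elements form only a real vector space, but rescaling by
    positive reals is all that passing from a neighbourhood of 0 to a linear
    bound requires. *)
Lemma weakly_continuous_bound (R : realType) (A : normedStarAlgType R[i])
    (H : lmodType R[i]) (dot : {dot H for @Num.conj R[i]})
    (pi : A -> {linear H -> H}) :
  representation dot pi -> weakly_continuous_on_sa dot pi ->
  forall x : H, exists2 C : R, 0 <= C &
    forall c : A, selfadjoint A c ->
      complex.Re (dot (pi c x) x) <= C * rnorm c.
Proof.
move=> rep wc x.
have pi0 : pi 0 x = 0 by rewrite -(scale0r (0 : A)) (repZ rep) scale0r.
have star0 : star (0 : A) = 0.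
  by rewrite -{1}(scale0r (0 : A)) starZ rmorph0 scale0r.
have /subspace_continuousP/(_ 0 star0) := wc x.
move=> /cvgrPdist_lt /(_ 1 ltr01); rewrite near_withinE => /nbhs_norm0P.
move=> [e /= e_gt0 He].
have {e_gt0 He} [d d_gt0 near0] : exists2 d : R, 0 < d &
    forall c : A, selfadjoint A c -> rnorm c < d ->
      complex.Re (dot (pi c x) x) < 1.
  exists (complex.Re e); first by move: e_gt0; rewrite ltcE => /andP[].
  move=> c sa_c c_lt; have /He/(_ sa_c) : `|c| < e.
    by rewrite complex_normE -[e]RRe_real ?gtr0_real// ltcR.
  rewrite /from_subspace pi0 linear0l sub0r normrN => lt1.
  have := le_lt_trans (normc_ge_Re _) lt1; rewrite (ltcR _ 1).
  exact/le_lt_trans/ler_norm.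
exists (2 / d) => [|c sa_c]; first by rewrite divr_ge0// ltW.
have [->|c_neq0] := eqVneq c 0; first by rewrite pi0 linear0l /rnorm normr0
  mulr0.
have N_gt0 : 0 < rnorm c by rewrite rnorm_gt0.
(* The factor [t] shrinks [c] to norm [d / 2], inside the ball of radius [d]. *)
pose t := d / (2 * rnorm c).
have t_gt0 : 0 < t by rewrite divr_gt0// mulr_gt0.
have sa_tc : selfadjoint A (t%:C *: c).
  by rewrite /selfadjoint /= starZ conj_realC sa_c.
have := near0 _ sa_tc; rewrite rnormZ_real gtr0_norm//.
have -> : t * rnorm c = d / 2 by rewrite /t; field; rewrite gt_eqF.
rewrite ltr_pdivrMr// ltr_pMr// ltr1n => /(_ isT).
rewrite (repZ rep) linearZl_LR Re_realM /t mulrC => lt1.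
rewrite ltW// -[ltLHS]mulr1 -[1](divff (lt0r_neq0 t_gt0)) mulrA ltr_pdivrMr//.
rewrite (lt_le_trans lt1)// /t le_eqVlt; apply/orP; left; apply/eqP; field.
by rewrite !gt_eqF.
Qed.

(** * Moments of a vector *)

Section AlternatingOrbit.
Context {R : realType} {A : normedStarAlgType R[i]} {H : lmodType R[i]}.
Variables (dot : {dot H for @Num.conj R[i]}) (pi : A -> {linear H -> H}).
Hypothesis rep : representation dot pi.
Variables (a : A) (x : H).

Let alt k := if odd k then star a else a.

(** The interleaving x, pi(a) x, pi(star a) pi(a) x, pi(a) pi(star a) pi(a) x,
    and so on: it treats the even moments |pi(b)^j x|^2 and the odd moments
    |pi(a) pi(b)^j x|^2 of b = (star a) a in the same way. *)
Fixpoint orbit_vec k : H := if k is m.+1 then pi (alt m) (orbit_vec m) else x.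

Definition moment k : R := complex.Re (dot (orbit_vec k) (orbit_vec k)).

Lemma rep_apowS (c : A) n (y : H) : pi (apowS c n) y = iter n.+1 (pi c) y.
Proof. by elim: n => [|n IH] //=; rewrite (repM rep) IH. Qed.

Lemma orbit_vec_double n :
  orbit_vec n.*2 = iter n (pi (amul (star a) a)) x.
Proof.
elim: n => [|n IH] //.
by rewrite doubleS /= -IH /alt /= odd_double /= (repM rep).
Qed.

(** Indices of equal parity select the same operator, and moving it to the other
    side of the inner product turns it into the next one of the alternation. *)
Lemma dot_orbit_vecS i j : odd i = odd j ->
  dot (orbit_vec i.+1) (orbit_vec j.+1) = dot (orbit_vec i.+2) (orbit_vec j).
Proof.
move=> par; rewrite [in RHS]/= (rep_star rep) /= /alt /= par.
by case: (odd j); rewrite /= ?starK.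
Qed.

Lemma dot_orbit_vec_shift i j :
  dot (orbit_vec (i.*2 + j)) (orbit_vec j) = dot (orbit_vec (i + j).*2) x.
Proof.
elim: j i => [|j IH] i; first by rewrite !addn0.
rewrite addnS dot_orbit_vecS ?oddD ?odd_double//.
by rewrite addnS -(addSn i j) -IH doubleS !addSn.
Qed.

Lemma moment_ge0 k : 0 <= moment k.
Proof. exact: dot_Re_ge0. Qed.

Lemma moment_log_convex k : moment k.+1 ^+ 2 <= moment k * moment k.+2.
Proof.
by rewrite /moment dot_orbit_vecS// [leRHS]mulrC; exact: dot_Re_CauchySchwarz.
Qed.

(** Although [moment] is defined by a squared norm, it is the value at a power
    of (star a) a of the functional that weak continuity controls. *)
Lemma moment_power k n :
  moment (k.+1 * n.+1) =
  complex.Re (dot (pi (apowS (apowS (amul (star a) a) n) k) x) x).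
Proof.
have := dot_orbit_vec_shift 0 (k.+1 * n.+1); rewrite !add0n /moment => ->.
rewrite orbit_vec_double iterM rep_apowS.
by congr (complex.Re (dot _ x)); apply: eq_iter => y; rewrite rep_apowS.
Qed.

(** Log-convexity bounds s_1 by s_K with K = (k+1)(n+1), weak continuity bounds
    s_K by C |b^(n+1)|^(k+1), and letting k grow removes the constant. *)
Lemma moment1_le n : weakly_continuous_on_sa dot pi ->
  moment 1 ^+ n.+1 <= moment 0 ^+ n.+1 * rnorm (apowS (amul (star a) a) n).
Proof.
move=> wc; set b := amul (star a) a.
have sa_b : selfadjoint A b by rewrite /selfadjoint /= starM starK.
have [C C_ge0 bndC] := weakly_continuous_bound _ _ _ _ _ rep wc x.
have [m0|m0_neq0] := eqVneq (moment 0) 0.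
  have := moment_log_convex 0; rewrite m0 mul0r => sq_le0.
  have /eqP : moment 1 ^+ 2 == 0 by rewrite eq_le sq_le0 sqr_ge0.
  by move/eqP; rewrite sqrf_eq0 => /eqP ->; rewrite !expr0n mul0r.
have m0_gt0 : 0 < moment 0 by rewrite lt_def m0_neq0 moment_ge0.
apply: (le_of_geometric_bound _ (C / moment 0)) => [||k].
- exact/exprn_ge0/moment_ge0.
- by rewrite mulr_ge0 ?rnorm_ge0// exprn_ge0// moment_ge0.
rewrite mulrAC ler_pdivlMr// exprMn -!exprM mulnC.
apply: le_trans (log_convex_pow _ _ moment_ge0 moment_log_convex _) _.
rewrite mulrCA ler_wpM2l ?exprn_ge0 ?moment_ge0//.
rewrite moment_power; apply: le_trans (bndC _ _) _.
  exact/selfadjoint_apowS/selfadjoint_apowS.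
by rewrite ler_wpM2l// rnorm_apowS_le.
Qed.

End AlternatingOrbit.

(** * The operator bound *)

Lemma hnorm_rep_le (R : realType) (A : normedStarAlgType R[i])
    (H : lmodType R[i]) (dot : {dot H for @Num.conj R[i]})
    (pi : A -> {linear H -> H}) :
  representation dot pi -> weakly_continuous_on_sa dot pi ->
  forall (a : A) (x : H), hnorm dot (pi a x) <= r_sigma a * hnorm dot x.
Proof.
move=> rep wc a x; set b := amul (star a) a.
pose s := moment dot pi a x.
have s_ge0 k : 0 <= s k by exact: moment_ge0.
(* Merging the two square roots is legitimate because r_lambda b >= 0. *)
rewrite /hnorm /r_sigma -/b -sqrtrM; last first.
  apply: lb_le_inf; first by eexists; exists 0%N.
  by move=> _ [n _ <-]; exact: powR_ge0.
apply: ler_wsqrtr; change (s 1%N <= r_lambda b * s 0%N).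
have [s0|s0_neq0] := eqVneq (s 0%N) 0.
  by have := moment1_le _ _ rep a x 0 wc; rewrite -/s s0 mulr0 !expr1 mul0r.
have s0_gt0 : 0 < s 0%N by rewrite lt_def s0_neq0 s_ge0.
rewrite -ler_pdivrMr//; apply: lb_le_inf; first by eexists; exists 0%N.
have y_ge0 : 0 <= s 1%N / s 0%N by rewrite divr_ge0.
move=> _ [n _ <-].
have -> : s 1%N / s 0%N = ((s 1%N / s 0%N) ^+ n.+1) `^ n.+1%:R^-1.
  by rewrite -powR_mulrn// -powRrM divff// powRr1.
apply: ge0_ler_powR; rewrite ?nnegrE ?invr_ge0 ?exprn_ge0 ?rnorm_ge0//.
rewrite expr_div_n ler_pdivrMr ?exprn_gt0// mulrC.
exact: moment1_le.
Qed.

Theorem theorem22p5 (R : realType) (A : normedStarAlgType R[i])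
    (H : lmodType R[i]) (dot : {dot H for @Num.conj R[i]})
    (pi : A -> {linear H -> H}) :
  representation dot pi ->
  weakly_continuous_on_sa dot pi ->
  forall a : A, bounded_op dot (pi a) /\ opnorm dot (pi a) <= r_sigma a.
Proof.
move=> rep wc a; have bnd := hnorm_rep_le _ _ _ _ _ rep wc a.
split; first by exists (r_sigma a).
apply: ge_sup; first by exists (hnorm dot (pi a 0)), 0 => //=;
  rewrite /hnorm linear0l sqrtr0.
move=> _ [x /= x_le1 <-]; apply: le_trans (bnd x) _.
by rewrite -[leRHS]mulr1 ler_wpM2l// sqrtr_ge0.
Qed.
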